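(* For every $0<\varepsilon<1$ there is a deterministic $\mathrm{DistLocal}[\Delta^{O(1/\varepsilon)} + O(1/\varepsilon^2)\cdot\log^*(n)]$-algorithm for computing a $(1-\varepsilon)$-approximate maximum cardinality matching, i.e., a matching $M$ with $|M|\ge(1-\varepsilon)|M^*|$ where $M^*$ is a maximum cardinality matching.
   Context: In the DistLocal model, computation takes place on an undirected graph $G$ with $n$ vertices and maximum degree $\Delta$; each vertex is a processor whose local input includes its ID (distinct, bounded by a polynomial in $n$), its degree, $\Delta$, $n$, and its ports (numbered pointers to its neighbors). Computation proceeds in synchronous rounds; in each round every vertex receives messages from its neighbors, performs arbitrary local computation, and sends a message (of unbounded length) to each neighbor. After the last round each vertex computes its local output (here: which of its incident edges are in the matching). A $\mathrm{DistLocal}[r]$-algorithm uses $r$ rounds. *)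

(* Defs.v *)
From HB Require Import structures.
From mathcomp Require Import all_boot all_order all_algebra.
From mathcomp Require Import reals exp.
From mathcomp Require Import lra.
Set Implicit Arguments.
Unset Strict Implicit.
Unset Printing Implicit Defensive.
Import Order.TTheory GRing.Theory Num.Theory.

Record sgraph := SGraph {
  vertex :> finType;
  adj : rel vertex;
  adj_sym : symmetric adj;
  adj_irr : irreflexive adj }.

Section Graphs.
Variable G : sgraph.
Implicit Types (u v : G) (M : {set {set G}}).

Definition degree v : nat := #|[set u | adj v u]|.
Definition max_degree : nat := \max_(v : G) degree v.
Definition edges : {set {set G}} := [set [set u; v] | u in [set: G], v in [set v | adj u v]].
Definition matching M : Prop := M \subset edges /\ trivIset M.
Definition maximum_matching M : Prop :=
  matching M /\ forall M' : {set {set G}}, matching M' -> #|M'| <= #|M|.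

End Graphs.

(* The i-th entry of [ports v] is the neighbour reached through port i of v;
   ports are numbered from 0. *)
Record network (G : sgraph) := Network {
  vid : G -> nat;
  ports : G -> seq G;
  vid_inj : injective vid;
  ports_uniq : forall v, uniq (ports v);
  mem_ports : forall u v, (v \in ports u) = adj u v }.

(* A vertex does not see who sits behind a port: it knows its ports
   0, ..., in_degree - 1 by number only. *)
Record local_input := LocalInput {
  in_id : nat;
  in_degree : nat;
  in_max_degree : nat;
  in_order : nat }.

(* [send s i] is the message put on port i by a vertex in state s;
   [step s ms] is its next state when [nth _ ms i] was received on port i;
   [output s i] tells whether the edge at port i is selected. *)
Record algorithm := Algorithm {
  state : Type;
  message : Type;
  init : local_input -> state;
  send : state -> nat -> message;
  step : state -> seq message -> state;
  output : state -> pred nat }.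

Section Execution.
Variables (A : algorithm) (G : sgraph) (N : network G).

Definition port (u v : G) : nat := index v (ports N u).

Definition input (v : G) : local_input :=
  LocalInput (vid N v) (degree v) (max_degree G) #|G|.

Definition round (s : G -> state A) : G -> state A :=
  fun v => step (s v) [seq send (s u) (port u v) | u <- ports N v].

Definition run (t : nat) : G -> state A :=
  iter t round (fun v => init A (input v)).

(* Quantifying over both orientations of an edge makes its endpoints agree. *)
Definition outputs_edge_set (t : nat) (M : {set {set G}}) : Prop :=
  forall u v : G, adj u v -> output (run t u) (port u v) = ([set u; v] \in M).

End Execution.

Local Open Scope ring_scope.

Section LogStar.
Variable R : realType.
Implicit Types x : R.

Definition log2 x : R := ln x / ln 2.

Lemma log2_le x : log2 x <= Num.max 1 (x - 1).
Proof.
have ln2 : 0 < ln (2 : R) by rewrite ln_gt0 ?ltr1n.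
rewrite le_max /log2 !ler_pdivrMr // mul1r.
have [x2|x2] := leP x 2.
  have [x0|x0] := leP x 0; first by rewrite (ln0 x0) ltW.
  have -> // : ln x <= ln 2 by rewrite ler_ln ?posrE.
apply/orP; right.
have x0 : 0 < x by lra.
have -> : ln x = ln 2 + ln (x / 2).
  by rewrite -lnM ?posrE ?divr_gt0 // mulrC divfK // pnatr_eq0.
have h1 : ln (x / 2) <= x / 2 - 1.
  have := @le_ln1Dx R (x / 2 - 1); rewrite (addrC 1) subrK; apply; lra.
have h2 : 1 - 2^-1 <= ln (2 : R).
  have := @le_ln1Dx R (2^-1 - 1); rewrite (addrC 1) subrK lnV ?posrE // => h.
  have : - ln (2 : R) <= 2^-1 - 1 by apply: h; lra.
  lra.
nra.
Qed.

Lemma iter_log2_le1 x : exists k, iter k log2 x <= 1.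
Proof.
have H k : iter k log2 x <= Num.max 1 (x - k%:R).
  elim: k => [|k IH] /=; first by rewrite subr0 le_max lexx orbT.
  apply: le_trans (log2_le _) _.
  rewrite ge_max !le_max lexx /= -natr1.
  move: IH; rewrite le_max => /orP[h|h]; apply/orP; first by left; lra.
  by right; lra.
exists (Num.bound `|x|); apply: le_trans (H _) _.
rewrite ge_max lexx /=.
set y := `|x|; have hy : y < (Num.bound y)%:R by apply: archi_boundP; exact: normr_ge0.
have := ler_norm x; rewrite -/y; lra.
Qed.

Definition log_star x : nat := ex_minn (iter_log2_le1 x).

End LogStar.

(* Main.v *)
(* With k about 2/eps, Linial's colour reduction iterated log* n times gives a colouring with
   Delta^O(k) colours in which vertices at distance at most 4k get distinct colours; each
   iteration costs 4k rounds. Then 2k(2k+1) sweeps over the colour classes are made: when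
   its turn comes, an unmatched vertex looks for an augmenting path of length at most 2k
   starting from it and flips it; simultaneous flips are disjoint because of the colouring.
   Let s and s* be the numbers of vertices matched by the current and by an optimal
   matching. The vertices X touched by a sweep hit every augmenting path of length less
   than 2k present at its start, whence k s* <= (k + 1) s + 2k |X|, while |X| is at most
   2k + 1 times the growth of s. Hence s grows by more than s* / 2k(2k+1) in each sweep
   until (k + 1) s >= (k - 1) s*.

   Message passing is dealt with once and for all: a function of the vertices is computable
   in t rounds as soon as it factors through the view gathered by the full-information
   algorithm in t rounds, and such functions are closed under collecting their values along
   all walks of length at most l at the cost of l rounds. *)
Require Import Defs.
From mathcomp Require Import all_boot all_order all_algebra.
From mathcomp Require Import finfield.
From mathcomp Require Import boolp reals exp.
From mathcomp Require Import zify lra.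
Set Implicit Arguments.
Unset Strict Implicit.
Unset Printing Implicit Defensive.
Import Order.TTheory GRing.Theory Num.Theory.

(** * Locality *)

Inductive view := Leaf of local_input | Node of view & seq view.

Fixpoint view_input (s : view) : local_input :=
  match s with Leaf i => i | Node s' _ => view_input s' end.

Fixpoint views (G : sgraph) (N : network G) (t : nat) (v : G) : view :=
  if t is t'.+1 then Node (views N t' v) [seq views N t' u | u <- ports N v]
  else Leaf (input N v).

Lemma view_input_views (G : sgraph) (N : network G) t (v : G) :
  view_input (views N t v) = input N v.
Proof. by elim: t. Qed.

Definition full_information (out : view -> pred nat) : algorithm :=
  @Algorithm view view Leaf (fun s _ => s) Node out.

Lemma run_full_information out (G : sgraph) (N : network G) t (v : G) :
  run (full_information out) N t v = views N t v.
Proof. by elim: t v => // t IH v; rewrite [RHS]/= -IH -(eq_map IH). Qed.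

Definition netfun (X : Type) := forall G : sgraph, network G -> G -> X.

Definition local (X : Type) (t : nat) (f : netfun X) : Prop :=
  exists F : view -> X, forall G (N : network G) v, f G N v = F (views N t v).

Definition vertex_map := forall G : sgraph, network G -> G -> G.

(* A processor can only refer to a vertex by its identifier. *)
Definition local_vertex (t : nat) (m : vertex_map) : Prop :=
  local t (fun G N v => vid N (m G N v)).

(* Every vertex knows #|G| and max_degree G, so it can select the member of the family. *)
Lemma algorithm_of_local (r : nat -> nat -> nat) (f : nat -> nat -> netfun (pred nat)) :
  (forall n D, local (r n D) (f n D)) ->
  exists A : algorithm, forall G (N : network G) (v : G),
    output (run A N (r #|G| (max_degree G)) v) = f #|G| (max_degree G) G N v.
Proof.
move=> f_local; have [F FE] := choice (fun nD => f_local nD.1 nD.2).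
exists (full_information (fun s =>
  F (in_order (view_input s), in_max_degree (view_input s)) s)) => G N v.
by rewrite run_full_information /= view_input_views [RHS](FE (_, _)).
Qed.

Section Locality.
Variables X Y Z : Type.
Implicit Types (f : netfun X) (g : netfun Y).

Lemma local_vid : local_vertex 0 (fun G _ v => v).
Proof. by exists (fun s => in_id (view_input s)). Qed.

Lemma eq_local t f f' : (forall G (N : network G) v, f G N v = f' G N v) ->
  local t f -> local t f'.
Proof. by move=> ff' [F fE]; exists F => G N v; rewrite -ff' fE. Qed.

Lemma local_map (h : X -> Y) t f :
  local t f -> local t (fun G N v => h (f G N v)).
Proof. by case=> F fE; exists (h \o F) => G N v /=; rewrite fE. Qed.

Lemma local_map2 (h : X -> Y -> Z) t f g : local t f -> local t g ->
  local t (fun G N v => h (f G N v) (g G N v)).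
Proof.
case=> F fE [F' gE]; exists (fun s => h (F s) (F' s)) => G N v.
by rewrite fE gE.
Qed.

Lemma leq_local t t' f : t <= t' -> local t f -> local t' f.
Proof.
move=> /subnK <-; elim: (t' - t) => // n IH /IH[F fE].
by exists (fun s => if s is Node s' _ then F s' else F s) => G N v; rewrite fE.
Qed.

Lemma local_ports t f : local t f ->
  local t.+1 (fun G N v => [seq f G N u | u <- ports N v]).
Proof.
case=> F fE; exists (fun s => if s is Node _ ss then map F ss else [::]) => G N v.
by rewrite /= -map_comp; apply: eq_map => u; rewrite fE.
Qed.

End Locality.

Section Balls.
Variable G : sgraph.
Implicit Types u v w : G.

Fixpoint ball l v : {set G} :=
  if l is l'.+1 then v |: \bigcup_(u in [set u | adj v u]) ball l' u else [set v].

Lemma ballP l v u :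
  reflect (exists s, [/\ path (@adj G) v s, size s <= l & last v s = u]) (u \in ball l v).
Proof.
apply: (iffP idP) => [|[s []]].
  elim: l v => [|l IH] v /=; first by rewrite inE => /eqP->; exists [::].
  rewrite !inE => /predU1P[->|/bigcupP[w]]; first by exists [::].
  by rewrite inE => vw /IH[s [ws sl <-]]; exists (w :: s); rewrite /= vw.
elim: l v s => [|l IH] v [|w s] //=; rewrite ?inE; do ?by move=> _ _ ->; rewrite eqxx.
move=> /andP[vw ws] sl su; apply/orP; right; apply/bigcupP; exists w; rewrite ?inE //.
exact: IH ws _ _.
Qed.

Lemma ball_sym l : symmetric (fun u v => v \in ball l u).
Proof.
suff ball_rev u v : v \in ball l u -> u \in ball l v.
  by move=> u v; apply/idP/idP; exact: ball_rev.
move=> /ballP[s [us sl <-]]; apply/ballP; exists (rev (belast u s)).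
rewrite rev_path size_rev size_belast; split=> //.
  by rewrite (eq_path (e' := @adj G)) // => x y; rewrite adj_sym.
by case: s {us sl} => //= w s; rewrite rev_cons last_rcons.
Qed.

Lemma ball_trans l1 l2 u v w :
  v \in ball l1 u -> w \in ball l2 v -> w \in ball (l1 + l2) u.
Proof.
move=> /ballP[s [us sl sv]] /ballP[t [vt tl <-]]; apply/ballP; exists (s ++ t).
by rewrite cat_path us sv vt size_cat leq_add // last_cat sv.
Qed.

Lemma path_ball l v s : path (@adj G) v s -> size s <= l -> {subset v :: s <= ball l v}.
Proof.
move=> + + u us; case/splitPl: us => s1 s2 su vs sl; apply/ballP; exists s1.
move: vs; rewrite cat_path => /andP[-> _]; split=> //.
by apply: leq_trans sl; rewrite size_cat leq_addr.
Qed.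

End Balls.

Lemma card_bigcup_leq (I : Type) (T : finType) (r : seq I) (P : pred I) (A : I -> {set T}) :
  #|\bigcup_(i <- r | P i) A i| <= \sum_(i <- r | P i) #|A i|.
Proof.
elim/big_ind2: _ => // [|B n C n' Bn Cn]; first by rewrite cards0.
by apply: leq_trans (leq_card_setU _ _) _; exact: leq_add.
Qed.

Lemma card_ball (G : sgraph) l (v : G) : #|ball l v| <= (max_degree G).+1 ^ l.
Proof.
elim: l v => [|l IH] v; first by rewrite /= cards1.
apply: leq_trans (leq_card_setU _ _) _; rewrite cards1 expnS mulSn.
apply: leq_add; first by rewrite expn_gt0.
apply: leq_trans (card_bigcup_leq _ _ _) _.
apply: (@leq_trans (\sum_(u in [set u | adj v u]) (max_degree G).+1 ^ l)).
  by apply: leq_sum => u _; exact: IH.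
by rewrite sum_nat_const leq_mul2r (leq_bigmax v) orbT.
Qed.

Section Walks.
Variables (G : sgraph) (N : network G).
Implicit Types (v : G) (s : seq G).

(* The starting vertex is left out, as in [path]. *)
Fixpoint walks l v : seq (seq G) :=
  if l is l'.+1 then [::] :: [seq u :: s | u <- ports N v, s <- walks l' u] else [:: [::]].

Lemma mem_walks l v s : (s \in walks l v) = path (@adj G) v s && (size s <= l).
Proof.
elim: l v s => [|l IH] v [|u s] //=; first by rewrite inE ltn0 andbF.
rewrite inE /= ltnS -andbA -(IH u) -(mem_ports N).
apply/allpairsPdep/andP => [[_ [_ [vu us [-> ->]]]]|[vu us]] //.
by exists u, s.
Qed.

Definition gather (X : Type) l (f : G -> X) v : seq X := [seq f (last v s) | s <- walks l v].

Lemma mem_gather (X : eqType) l (f : G -> X) v x :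
  reflect (exists2 u, u \in ball l v & x = f u) (x \in gather l f v).
Proof.
apply: (iffP mapP) => [[s + ->]|[u /ballP[s [vs sl <-]] ->]].
  by rewrite mem_walks => /andP[vs sl]; exists (last v s) => //; apply/ballP; exists s.
by exists s; rewrite // mem_walks vs.
Qed.

Lemma size_undup_gather (X : eqType) l (f : G -> X) v :
  size (undup (gather l f v)) <= #|ball l v|.
Proof.
rewrite cardE -(size_map f); apply: uniq_leq_size (undup_uniq _) _ => x.
by rewrite mem_undup => /mem_gather[u uv ->]; apply: map_f; rewrite mem_enum.
Qed.

End Walks.

Lemma local_walks (X : Type) t l (f : netfun X) : local t f ->
  local (t + l) (fun G N v => [seq map (f G N) (v :: s) | s <- walks N l v]).
Proof.
move=> f_local; elim: l => [|l IH].
  by rewrite addn0; exact: local_map (fun x => [:: [:: x]]) _ _ f_local.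
rewrite addnS; have le_t : t <= (t + l).+1 by rewrite -addnS leq_addr.
apply: eq_local (local_map2 (fun x zss => [:: x] :: [seq x :: z | z <- flatten zss])
  (leq_local le_t f_local) (local_ports IH)) => G N v /=.
rewrite map_flatten map_allpairs -!map_comp; congr (_ :: flatten _).
by apply: eq_map => u /=; rewrite -map_comp.
Qed.

Lemma local_gather (X : Type) t l (f : netfun X) : local t f ->
  local (t + l) (fun G N v => gather N l (f G N) v).
Proof.
move=> f_local; apply: eq_local (local_map2 (fun x zs => [seq last x z | z <- zs])
  (leq_local (leq_addr l t) f_local) (local_walks l f_local)) => G N v.
by rewrite -map_comp; apply: eq_map => s /=; rewrite last_map.
Qed.

(** * Linial's colour reduction *)

Lemma eq_digits b n x y : x < b ^ n -> y < b ^ n ->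
  (forall i, i < n -> x %/ b ^ i = y %/ b ^ i %[mod b]) -> x = y.
Proof.
elim: n x y => [|n IH] x y; first by rewrite expn0 !ltnS !leqn0 => /eqP-> /eqP->.
rewrite expnSr => xb yb xy; have b_gt0 : 0 < b by case: (b) xb => //; rewrite muln0.
rewrite (divn_eq x b) (divn_eq y b); have /= := xy 0 isT.
rewrite expn0 !divn1 => ->; congr (_ * b + _).
apply: IH => [||i i_lt]; rewrite ?ltn_divLR //.
by rewrite -!divnMA -expnS xy.
Qed.

Section Polynomials.
Local Open Scope ring_scope.

Definition digit_poly (F : nzRingType) a c : {poly F} :=
  \poly_(i < a) (c %/ 2 ^ i %% 2)%N%:R.

Lemma size_digit_poly (F : nzRingType) a c : (size (digit_poly F a c) <= a)%N.
Proof. exact: size_poly. Qed.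

Lemma digit_poly_inj (F : nzRingType) a c c' : (c < 2 ^ a)%N -> (c' < 2 ^ a)%N ->
  digit_poly F a c = digit_poly F a c' -> c = c'.
Proof.
move=> ca c'a E; apply: (eq_digits ca c'a) => i ia.
move/(congr1 (fun q : {poly F} => q`_i)): E; rewrite !coef_poly ia !modn2.
by case: odd; case: odd => //= /eqP; rewrite ?oner_eq0 // eq_sym oner_eq0.
Qed.

Lemma card_horner_eq (F : finFieldType) n (q q' : {poly F}) :
  (size q <= n)%N -> (size q' <= n)%N -> q != q' -> (#|[set x | q.[x] == q'.[x]]| < n)%N.
Proof.
rewrite -subr_eq0 => qn q'n ne.
apply: (@leq_trans (size (q - q'))); last first.
  by apply: leq_trans (size_polyD _ _) _; rewrite size_polyN geq_max qn.
rewrite cardE; apply: max_poly_roots (ne) _ (enum_uniq _).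
by apply/allP => x; rewrite mem_enum inE -subr_eq0 /root !hornerE.
Qed.

Lemma exists_separating_point (F : finFieldType) n (q : {poly F}) (qs : seq {poly F}) :
  (size q <= n)%N -> {in qs, forall q' : {poly F}, (size q' <= n)%N} ->
  (size qs * n < #|F|)%N ->
  exists x, {in qs, forall q' : {poly F}, q' != q -> q.[x] != q'.[x]}.
Proof.
move=> qn qsn card_F.
pose bad : {set F} := \bigcup_(q' <- qs | q' != q) [set x | q.[x] == q'.[x]].
have card_bad : (#|bad| < #|F|)%N.
  apply: leq_ltn_trans card_F; apply: leq_trans (card_bigcup_leq _ _ _) _.
  rewrite -sum1_size big_distrl /= big_seq_cond [leqRHS]big_seq big_mkcondr /=.
  apply: leq_sum => q' q'qs; rewrite mul1n; case: ifP => // ne.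
  by apply/ltnW/card_horner_eq; rewrite // ?qsn // eq_sym.
have /existsP[x x_good] : [exists x, x \notin bad].
  rewrite -negb_forall; apply: contraL card_bad => /forallP all_bad.
  by rewrite -leqNgt -cardsT; apply/subset_leq_card/subsetP => x _; exact: all_bad.
exists x => q' q'qs ne; apply: contra x_good => qx.
by rewrite /bad (big_rem q') //= ne !inE qx.
Qed.

End Polynomials.

Definition linial_bits (d a : nat) : nat := (d + trunc_log 2 a).+1.*2.

Definition linial_field (e : nat) : finFieldType :=
  s2val (pPrimePowerField (isT : prime 2) (ltn0Sn e)).

Lemma card_linial_field e : #|linial_field e| = 2 ^ e.+1.
Proof. exact: (s2valP' (pPrimePowerField (isT : prime 2) (ltn0Sn e))). Qed.

Definition separating_point (F : finFieldType) a c (cs : seq nat) : F :=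
  odflt 0%R [pick x | all (fun c' =>
    (c' != c) ==> ((digit_poly F a c).[x] != (digit_poly F a c').[x])%R) cs].

(* Reed-Solomon codes: a colour of [a] bits is read as a polynomial over the field with
   2 ^ (d + log a + 1) elements, and the new colour is a point of its graph that lies on
   none of the graphs of the neighbours' polynomials. *)
Definition linial_color (d a c : nat) (cs : seq nat) : nat :=
  let F := linial_field (d + trunc_log 2 a) in
  let x := separating_point F a c cs in
  enum_rank (x, (digit_poly F a c).[x]%R).

Lemma linial_color_lt d a c cs : linial_color d a c cs < 2 ^ linial_bits d a.
Proof.
apply: leq_trans (ltn_ord _) _.
by rewrite card_prod card_linial_field -expnD addnn.
Qed.

Lemma separating_pointP (F : finFieldType) a c cs (x := separating_point F a c cs) :
  size (undup cs) * a < #|F| -> c < 2 ^ a -> {in cs, forall c', c' < 2 ^ a} ->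
  {in cs, forall c', c' != c -> (digit_poly F a c).[x] != (digit_poly F a c').[x]}%R.
Proof.
move=> card_F ca csa; rewrite /x /separating_point; case: pickP => [y|no_point].
  by move=> /allP y_sep c' c'cs; apply/implyP/y_sep.
have [|//||y y_sep] := @exists_separating_point F a (digit_poly F a c)
    [seq digit_poly F a c' | c' <- undup cs].
- exact: size_digit_poly.
- by move=> _ /mapP[c' _ ->]; exact: size_digit_poly.
- by rewrite size_map.
have /negbT/allPn[c' c'cs] := no_point y; rewrite negb_imply => /andP[ne].
rewrite y_sep ?map_f ?mem_undup //; apply: contra ne => /eqP E.
exact/eqP/(digit_poly_inj (csa _ c'cs) ca E).
Qed.

Lemma linial_color_neq d a c c' cs cs' :
  size (undup cs) <= 2 ^ d -> c < 2 ^ a -> {in cs, forall c'', c'' < 2 ^ a} ->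
  c' \in cs -> c' != c -> linial_color d a c cs != linial_color d a c' cs'.
Proof.
move=> cs_d ca csa c'cs ne; apply/negP => /eqP/val_inj/enum_rank_inj[Ex Ey].
have card_F : size (undup cs) * a < #|linial_field (d + trunc_log 2 a)|.
  rewrite card_linial_field -addnS expnD; apply: leq_ltn_trans (leq_mul cs_d (leqnn a)) _.
  by rewrite ltn_pmul2l ?expn_gt0 // trunc_log_ltn.
by have := separating_pointP card_F ca csa c'cs ne; rewrite Ey Ex eqxx.
Qed.

Definition distance_coloring (G : sgraph) l (col : G -> nat) : Prop :=
  forall u v, v \in ball l u -> col v = col u -> v = u.

Definition dispersed (G : sgraph) l (P : pred G) : Prop :=
  {in P &, forall u v, v \in ball l u -> v = u}.

Lemma dispersed_coloring (G : sgraph) l (col : G -> nat) c :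
  distance_coloring l col -> dispersed l (fun v => col v == c).
Proof.
move=> colP u v; rewrite !unfold_in => /eqP uc /eqP vc uv.
by apply: colP uv _; rewrite uc.
Qed.

Fixpoint coloring (l d a i : nat) : netfun nat :=
  if i is i'.+1 then fun G N v =>
    linial_color d (iter i' (linial_bits d) a) (coloring l d a i' N v)
      (gather N l (@coloring l d a i' G N) v)
  else fun G N v => vid N v.

Lemma local_coloring l d a i : local (i * l) (coloring l d a i).
Proof.
elim: i => [|i IH]; first exact: local_vid.
rewrite mulSnr.
exact: local_map2 (leq_local (leq_addr l _) IH) (local_gather l IH).
Qed.

Section ColoringCorrect.
Variables (G : sgraph) (N : network G) (l d a : nat).
Hypotheses (vid_lt : forall v, vid N v < 2 ^ a) (ball_le : forall v : G, #|ball l v| <= 2 ^ d).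

Lemma coloring_lt i v : coloring l d a i N v < 2 ^ iter i (linial_bits d) a.
Proof. by case: i => [|i]; [exact: vid_lt|exact: linial_color_lt]. Qed.

Lemma coloring_distance i : distance_coloring l (coloring l d a i N).
Proof.
elim: i => [|i IH] u v uv; first exact: vid_inj.
apply: contraPeq => ne; apply/nesym/eqP.
apply: linial_color_neq => [|||//|].
- exact: leq_trans (size_undup_gather _ _ _ _) (ball_le u).
- exact: coloring_lt.
- by move=> _ /mem_gather[w _ ->]; exact: coloring_lt.
- by apply/mem_gather; exists v.
by apply: contra ne => /eqP/(IH _ _ uv)->.
Qed.

End ColoringCorrect.

(** * Alternation of two involutions *)

Section Alternation.
Variables (T : finType) (m ms : T -> T).
Hypotheses (mK : involutive m) (msK : involutive ms).
Implicit Types (v w : T) (i j k : nat) (A B : {set T}).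

Definition matched (f : T -> T) : {set T} := [set v | f v != v].

Fixpoint alternate j v : T :=
  if j is i.+1 then (if odd i then m else ms) (alternate i v) else v.

Definition moving j v : bool := [forall i : 'I_j, alternate i.+1 v != alternate i v].

Lemma movingP j v :
  reflect (forall i, i < j -> alternate i.+1 v != alternate i v) (moving j v).
Proof.
by apply: (iffP forallP) => [mov i ij|mov i]; [exact: (mov (Ordinal ij))|exact: mov].
Qed.

Lemma leq_moving i j v : i <= j -> moving j v -> moving i v.
Proof. by move=> ij /movingP mov; apply/movingP => a ai; apply/mov/(leq_trans ai). Qed.

Lemma alternate_back j v :
  (if odd j then m else ms) (alternate j.+1 v) = alternate j v.
Proof. by rewrite /=; case: odd; [rewrite mK|rewrite msK]. Qed.

Lemma alternate_inj i j v w : m v = v -> m w = w -> moving i v -> moving j w ->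
  odd i = odd j -> alternate i v = alternate j w -> i = j /\ v = w.
Proof.
wlog ij : i j v w / i <= j => [sym|].
  have [ij|/ltnW ji] := leqP i j; first exact: sym.
  by move=> mv mw vi wj oij /esym/sym[] // ->.
move=> mv _ _; elim: i j ij => [|i IH] [|j] //= ij mov_j oij E.
  have /movingP/(_ j (leqnn _)) := mov_j.
  by rewrite -(alternate_back j w) /= -E; move/esym/negbFE: oij => ->; rewrite mv eqxx.
have back_parity : odd i = odd j by move: oij; case: odd; case: odd.
have back_eq : alternate i v = alternate j w.
  by rewrite -(alternate_back i v) -(alternate_back j w) /= E back_parity.
by have [->->] := IH j ij (leq_moving (leqnSn j) mov_j) back_parity back_eq.
Qed.

(* From a coincidence at distance [2d + 1] both ends can be moved towards the middle. *)
Lemma alternate_stops_between a d v : alternate a v = alternate (a + d.*2.+1) v ->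
  alternate (a + d).+1 v = alternate (a + d) v.
Proof.
elim: d a => [|d IH] a; first by rewrite addn0 addn1.
move=> E; rewrite addnS -addSn; apply: IH.
have two_more : a + d.+1.*2.+1 = (a + d.*2.+1).+2 by lia.
have same_parity : odd (a + d.*2.+1).+1 = odd a by lia.
by rewrite addSn -(alternate_back (a + d.*2.+1).+1) same_parity -two_more -E.
Qed.

Lemma alternate_uniq j v : m v = v -> moving j v -> uniq (mkseq (alternate^~ v) j.+1).
Proof.
move=> mv mov; apply/mkseq_uniqP => a b; rewrite !inE !ltnS.
wlog ab : a b / a <= b => [sym|] aj bj E.
  by have [ab|/ltnW ba] := leqP a b; [exact: sym|symmetry; exact: sym].
have [oab|oab] := eqVneq (odd a) (odd b).
  by have [] := alternate_inj mv mv (leq_moving aj mov) (leq_moving bj mov) oab E.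
have b_eq : b = a + ((b - a)./2).*2.+1.
  have : odd (b - a) by rewrite oddB //; case: odd oab; case: odd.
  lia.
rewrite b_eq in E; have /eqP := alternate_stops_between E.
by rewrite (negbTE (movingP _ _ mov _ _)) //; lia.
Qed.

(* Distinct starting points use distinct vertices at even positions. *)
Lemma card_alternate_leq n (J : T -> 'I_n -> nat) A B : (forall v, injective (J v)) ->
  {in A, forall v (i : 'I_n),
    [/\ m v = v, moving (J v i).*2 v & alternate (J v i).*2 v \in B]} ->
  n * #|A| <= #|B|.
Proof.
move=> J_inj JP; rewrite -[n]card_ord -cardsT mulnC -cardsX.
rewrite -(card_in_imset (f := fun vi => alternate (J vi.1 vi.2).*2 vi.1)).
  apply/subset_leq_card/subsetP => _ /imsetP[[v i] + ->].
  by rewrite in_setX => /andP[/JP/(_ i)[]].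
move=> [v i] [w j]; rewrite !in_setX => /andP[/= vA _] /andP[/= wA _] E.
have [mv mov_v _] := JP v vA i; have [mw mov_w _] := JP w wA j.
have [|/double_inj Jij vw] := alternate_inj mv mw mov_v mov_w _ E.
  by rewrite !odd_double.
by subst w; rewrite (J_inj v i j).
Qed.

Section Gap.
Variable k : nat.

Definition stop v : nat :=
  find (fun j => alternate j.+1 v == alternate j v) (iota 0 k.*2).

Lemma stop_leq v : stop v <= k.*2.
Proof. by rewrite -[leqRHS](size_iota 0 k.*2) find_size. Qed.

Lemma moving_stop v : moving (stop v) v.
Proof.
apply/movingP => i i_lt; have := before_find 0 i_lt.
rewrite nth_iota ?add0n => [->//|].
exact: leq_trans i_lt (stop_leq v).
Qed.

Lemma alternate_stop v : stop v < k.*2 -> alternate (stop v).+1 v = alternate (stop v) v.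
Proof.
move=> v_stop; have := v_stop; rewrite -[ltnRHS](size_iota 0) -has_find.
by move=> /(nth_find 0)/eqP; rewrite -/(stop v) nth_iota.
Qed.

Lemma card_stop_even :
  #|[set v | [&& m v == v, stop v < k.*2 & ~~ odd (stop v)]]| <= #|~: matched ms|.
Proof.
rewrite -[leqLHS]mul1n.
apply: (@card_alternate_leq 1 (fun v _ => (stop v)./2)) => [v i j _|v].
  by rewrite !ord1.
rewrite !inE => /and3P[/eqP mv v_stop v_even] _.
rewrite even_halfK // negbK; split=> //; first exact: moving_stop.
by have := alternate_stop v_stop; rewrite /= (negbTE v_even) => ->.
Qed.

Lemma card_never_stop :
  k * #|[set v | (m v == v) && (stop v == k.*2)]| <= #|matched m|.
Proof.
apply: (@card_alternate_leq k (fun _ (i : 'I_k) => i.+1)) => [v i j [/val_inj]//|v].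
rewrite !inE => /andP[/eqP mv /eqP v_stop] i.
have mov : moving i.+1.*2 v.
  by apply: leq_moving (moving_stop v); rewrite v_stop leq_double.
split=> //; have /movingP/(_ i.*2.+1) := mov; rewrite doubleS leqnn eq_sym => /(_ isT).
by rewrite -{1}(alternate_back i.*2.+1 v) [odd _]/= odd_double inE.
Qed.

Variable X : {set T}.
Hypothesis stop_hits : forall v, m v = v -> stop v < k.*2 -> odd (stop v) ->
  has [in X] (mkseq (alternate^~ v) (stop v).+1).

Lemma card_stop_odd :
  #|[set v | [&& m v == v, stop v < k.*2 & odd (stop v)]]| <= #|X|.*2.
Proof.
pose hit v := find (fun j => alternate j v \in X) (iota 0 (stop v).+1).
apply: (@leq_trans #|X :|: ms @: X|); last first.
  rewrite -addnn; apply: leq_trans (leq_card_setU _ _) _.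
  by rewrite leq_add2l leq_imset_card.
rewrite -[leqLHS]mul1n.
apply: (@card_alternate_leq 1 (fun v _ => (hit v)./2)) => [v i j _|v].
  by rewrite !ord1.
rewrite !inE => /and3P[/eqP mv v_stop v_odd] _.
have := stop_hits mv v_stop v_odd; rewrite has_map => v_hit.
have hit_lt : hit v <= stop v by rewrite has_find size_iota in v_hit.
have hitX : alternate (hit v) v \in X.
  by have := nth_find 0 v_hit; rewrite nth_iota.
split=> //; first by apply: leq_moving (moving_stop v); lia.
move: hitX; rewrite -{1}(odd_double_half (hit v)).
case: (odd (hit v)) => /= [|->] //; rewrite odd_double /= => hitX.
by rewrite -{2}(msK (alternate _ v)) imset_f ?orbT.
Qed.

(* Each m-free vertex starts a path alternating between ms and m. The paths that stop
   within 2k steps end either at an ms-free vertex or, after an odd number of steps, at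
   an m-free vertex, and then they meet X; each of the others uses k m-matched vertices
   at its even positions. *)
Lemma card_matched_stop_hits :
  k * #|matched ms| <= k.+1 * #|matched m| + k.*2 * #|X|.
Proof.
have even_le := card_stop_even; have odd_le := card_stop_odd; have never_le := card_never_stop.
set evens := [set v | _] in even_le; set odds := [set v | _] in odd_le.
set nevers := [set v | _] in never_le.
have free_le : #|~: matched m| <= #|evens| + #|odds| + #|nevers|.
  apply: (@leq_trans #|evens :|: odds :|: nevers|).
    apply/subset_leq_card/subsetP => v; rewrite !inE negbK => ->.
    have := stop_leq v; rewrite leq_eqVlt => /predU1P[->|->]; first by rewrite eqxx orbT.
    by case: odd.
  by apply: leq_trans (leq_card_setU _ _) _; rewrite leq_add2r leq_card_setU.
have m_card := cardsC (matched m); have ms_card := cardsC (matched ms).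
have : #|matched ms| <= #|matched m| + #|nevers| + #|X|.*2 by lia.
rewrite -(leq_pmul2l (m := k.+1)) //; nia.
Qed.

End Gap.

End Alternation.

(** * Matchings and augmenting paths *)

Section Matchings.
Variable G : sgraph.
Implicit Types (m ms : G -> G) (u v w : G) (M : {set {set G}}).

(* A matching is encoded by its partner map, whose fixed points are the unmatched
   vertices. *)
Definition pairing m : Prop := involutive m /\ forall v, m v != v -> adj v (m v).

Definition partner M v : G := odflt v [pick u | [set v; u] \in M].

Definition pairs m : {set {set G}} := [set [set v; m v] | v in matched m].

Lemma adj_neq u v : adj u v -> u != v.
Proof. by apply: contraTneq => ->; rewrite adj_irr. Qed.

Lemma set2_inj u v w : u != v -> u != w -> [set u; v] = [set u; w] -> v = w.
Proof.
move=> uv uw E; have : v \in [set u; w] by rewrite -E !inE eqxx orbT.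
by rewrite !inE eq_sym (negbTE uv) => /eqP.
Qed.

Lemma mem_edges u v : ([set u; v] \in edges G) = adj u v.
Proof.
apply/imset2P/idP => [[a b _]|uv]; last by exists u v; rewrite ?inE.
rewrite inE => ab E.
have : a \in [set u; v] by rewrite E !inE eqxx.
have : b \in [set u; v] by rewrite E !inE eqxx orbT.
rewrite !inE => /orP[]/eqP eb /orP[]/eqP ea; move: ab; rewrite ea eb ?adj_irr //.
by rewrite adj_sym.
Qed.

Lemma edge_other_end u v x : adj u v -> x \in [set u; v] ->
  exists2 y, adj x y & [set u; v] = [set x; y].
Proof.
move=> uv; rewrite !inE => /orP[]/eqP->; first by exists v.
by exists u; [rewrite adj_sym|rewrite setUC].
Qed.

Lemma matching_edges : max_degree G <= 1 -> matching (edges G).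
Proof.
move=> deg; split=> //.
have adj_eq (x y z : G) : adj x y -> adj x z -> y = z.
  have /card_le1P nbr_eq : degree x <= 1 by apply: leq_trans deg; exact: leq_bigmax.
  move=> xy xz; have := nbr_eq y; rewrite inE => /(_ xy z).
  by rewrite !inE xz => /esym/eqP.
apply/trivIsetP => _ _ /imset2P[u v _ + ->] /imset2P[u' v' _ + ->].
rewrite !inE => uv uv'; apply: contraR; rewrite -setI_eq0 => /set0Pn[x].
rewrite inE => /andP[/(edge_other_end uv)[y xy ->] /(edge_other_end uv')[z xz ->]].
by rewrite (adj_eq x y z).
Qed.

Lemma card_cover_matching M : matching M -> #|cover M| = #|M|.*2.
Proof.
move=> [/subsetP ME trM]; rewrite -muln2; apply: card_uniform_partition => [e /ME|].
  by case/imset2P => a b _; rewrite inE => /adj_neq ab ->; rewrite cards2 ab.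
apply/and3P; split=> //; apply/negP => /ME/imset2P[a b _ _] /setP/(_ a).
by rewrite !inE eqxx.
Qed.

Lemma partner_eq M u v : matching M -> [set u; v] \in M -> partner M u = v.
Proof.
move=> [/subsetP ME /trivIsetP trM] uvM.
rewrite /partner; case: pickP => [w uwM|/(_ v)] /=; last by rewrite uvM.
have := ME _ uwM; have := ME _ uvM; rewrite !mem_edges.
move=> /adj_neq uv /adj_neq uw; apply: (@set2_inj u) => //; apply/eqP.
apply: contraT => /(trM _ _ uwM uvM)/disjoint_setI0/setP/(_ u).
by rewrite !inE eqxx.
Qed.

Lemma pairing_partner M : matching M -> pairing (partner M).
Proof.
move=> matM; split=> v.
  rewrite {2}/partner; case: pickP => [u vu|no_edge] /=.
    by rewrite (partner_eq (v := v)) // setUC.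
  by rewrite /partner; case: pickP => // u; rewrite no_edge.
rewrite /partner; case: pickP => /= [u vu _|_]; last by rewrite eqxx.
by rewrite -mem_edges; case: matM => /subsetP ME _; exact: ME.
Qed.

Lemma matched_partner M : matching M -> matched (partner M) = cover M.
Proof.
move=> matM; have [/subsetP ME _] := matM; apply/setP => v; rewrite inE.
apply/idP/bigcupP => [|[e eM ve]].
  rewrite /partner; case: pickP => /= [u vu _|_]; last by rewrite eqxx.
  by exists [set v; u]; rewrite // !inE eqxx.
have /imset2P[a b _] := ME _ eM; rewrite inE => ab eE; rewrite eE in ve eM.
have [u /adj_neq vu E] := edge_other_end ab ve.
by rewrite (partner_eq (v := u)) -?E // eq_sym.
Qed.

Lemma mem_pairs m u v : pairing m -> adj u v -> ([set u; v] \in pairs m) = (m u == v).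
Proof.
move=> [mK _] /adj_neq uv; apply/imsetP/eqP => [[a]|E]; last first.
  by exists u; rewrite ?inE E // eq_sym.
rewrite inE => ma E.
have [ua|ua] := eqVneq u a.
  by subst a; symmetry; apply: set2_inj E => //; rewrite eq_sym.
have : u \in [set a; m a] by rewrite -E !inE eqxx.
rewrite !inE (negbTE ua) /= => /eqP um; rewrite um mK.
move: E; rewrite um [RHS]setUC => E; symmetry; apply: set2_inj E => //.
by rewrite -um.
Qed.

Lemma matching_pairs m : pairing m -> matching (pairs m).
Proof.
move=> [mK m_adj]; split.
  apply/subsetP => _ /imsetP[v + ->].
  by rewrite inE mem_edges; exact: m_adj.
apply/trivIsetP => _ _ /imsetP[u _ ->] /imsetP[v _ ->]; apply: contraR.
rewrite -setI_eq0 => /set0Pn[x]; rewrite !inE => /andP[].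
move=> /orP[]/eqP-> /orP[]/eqP E; first by rewrite E.
- by rewrite E mK setUC.
- by rewrite -E mK setUC.
by rewrite (can_inj mK E).
Qed.

Lemma cover_pairs m : pairing m -> cover (pairs m) = matched m.
Proof.
move=> [mK _]; apply/setP => v; apply/bigcupP/idP => [[_ /imsetP[u um ->]]|vm].
  by rewrite !inE => /orP[]/eqP->; move: um; rewrite inE // mK eq_sym.
by exists [set v; m v]; [exact: imset_f|rewrite !inE eqxx].
Qed.

Lemma card_matched_pairs m : pairing m -> #|matched m| = #|pairs m|.*2.
Proof.
by move=> mP; rewrite -cover_pairs // card_cover_matching //; exact: matching_pairs.
Qed.

Lemma card_matched_partner M : matching M -> #|matched (partner M)| = #|M|.*2.
Proof. by move=> matM; rewrite matched_partner // card_cover_matching. Qed.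

(* Exchanging the partners along such a path matches all its vertices, so one only needs
   its vertex set to be closed under [m], not that it alternates. *)
Definition augmenting m v (s : seq G) : bool :=
  [&& path (@adj G) v s, uniq (v :: s), odd (size s), m v == v
    & all [pred u | m u \in v :: s] (v :: s)].

Lemma eq_in_augmenting m m' v s : {in v :: s, m =1 m'} -> augmenting m v s = augmenting m' v s.
Proof.
move=> mm'; rewrite /augmenting mm' ?mem_head //; do 4!congr (_ && _).
by apply: eq_in_all => u us /=; rewrite mm'.
Qed.

Section BoundedAugmentingPaths.
Variables (m ms : G -> G).
Hypotheses (mP : pairing m) (msP : pairing ms).

Let alt := alternate m ms.

Lemma cons_alternate j v :
  v :: mkseq (fun i => alt i.+1 v) j = mkseq (alt^~ v) j.+1.
Proof. by rewrite /mkseq /= -[1]addn0 iotaDl -map_comp. Qed.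

Lemma path_alternate j v : moving m ms j v ->
  path (@adj G) v (mkseq (fun i => alt i.+1 v) j).
Proof.
move=> /movingP mov; apply/(pathP v) => i; rewrite size_mkseq => ij.
rewrite nth_mkseq // cons_alternate nth_mkseq; last exact: ltnW.
by have := mov i ij => /=; case: odd; [case: mP => _; apply|case: msP => _; apply].
Qed.

Lemma augmenting_alternate j v : m v = v -> odd j -> moving m ms j v ->
  alt j.+1 v = alt j v -> augmenting m v (mkseq (fun i => alt i.+1 v) j).
Proof.
have [[mK _] [msK _]] := (mP, msP); move=> mv oj mov stop.
rewrite /augmenting cons_alternate size_mkseq; apply/and5P; split=> //.
- exact: path_alternate.
- exact: alternate_uniq.
- exact/eqP.
apply/allP => _ /mapP[i + ->].
rewrite mem_iota ltnS => /= ij; apply/mapP; case oi: (odd i).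
  have [->|ne] := eqVneq i j; first by exists j; rewrite ?mem_iota //= -[RHS]stop /alt /= oj.
  by exists i.+1; rewrite ?mem_iota /alt /= ?oi //; lia.
case: i oi ij => [|i] oi ij; first by exists 0; rewrite // mem_iota.
exists i; first by rewrite mem_iota; lia.
by have := alternate_back mK msK i v; move: oi => /= /negbFE ->.
Qed.

Lemma card_matched_augmenting_hits k (X : {set G}) :
  (forall v s, augmenting m v s -> size s < k.*2 -> has [in X] (v :: s)) ->
  k * #|matched ms| <= k.+1 * #|matched m| + k.*2 * #|X|.
Proof.
have [[mK _] [msK _]] := (mP, msP); move=> hits.
apply: card_matched_stop_hits => // v mv v_stop v_odd; rewrite -cons_alternate.
apply: hits; last by rewrite size_mkseq.
by apply: augmenting_alternate => //; [exact: moving_stop|exact: alternate_stop].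
Qed.

End BoundedAugmentingPaths.

End Matchings.

(** * Simultaneous augmentations *)

Section Mate.
Variable T : eqType.
Implicit Types (s : seq T) (x : T).

Definition swap_parity i : nat := if odd i then i.-1 else i.+1.

Lemma swap_parityK : involutive swap_parity.
Proof.
by move=> i; rewrite /swap_parity; case oi: (odd i); case: i oi => //= i; case: odd.
Qed.

Lemma swap_parity_neq i : swap_parity i != i.
Proof. by rewrite /swap_parity; case: ifP; case: i => //= i _; lia. Qed.

Lemma ltn_swap_parity n i : ~~ odd n -> i < n -> swap_parity i < n.
Proof. by rewrite /swap_parity; case: ifP; lia. Qed.

Definition mate s x : T := nth x s (swap_parity (index x s)).

Section EvenSize.
Variables (s : seq T) (x : T).
Hypotheses (s_even : ~~ odd (size s)) (xs : x \in s).

Let mate_index_lt : swap_parity (index x s) < size s.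
Proof. by rewrite ltn_swap_parity // index_mem. Qed.

Lemma mem_mate : mate s x \in s. Proof. exact: mem_nth. Qed.

Lemma mate_neq : uniq s -> mate s x != x.
Proof.
by move=> us; rewrite -{2}(nth_index x xs) nth_uniq ?index_mem // swap_parity_neq.
Qed.

Lemma mateK : uniq s -> mate s (mate s x) = x.
Proof.
move=> us; rewrite {1}/mate index_uniq // swap_parityK -[RHS](nth_index x xs).
by apply: set_nth_default; rewrite index_mem.
Qed.

Lemma mate_rel (e : rel T) : symmetric e -> sorted e s -> e x (mate s x).
Proof.
move=> e_sym /(sortedP x) es; rewrite /mate -{1}(nth_index x xs).
have := mate_index_lt; rewrite /swap_parity; case: ifP => oi lt_i; last exact: es.
rewrite e_sym; case: (index x s) oi (index_mem x s) lt_i => // i _ /= lt_i _.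
by apply: es; rewrite lt_i.
Qed.

End EvenSize.

End Mate.

Lemma mate_map (T U : eqType) (f : T -> U) s x : injective f ->
  mate (map f s) (f x) = f (mate s x).
Proof.
move=> f_inj; rewrite /mate index_map //; move: (swap_parity _) => i.
have [lt|le] := ltnP i (size s); first exact: nth_map.
by rewrite !nth_default ?size_map.
Qed.

Section Head.
Variables (T : eqType) (x0 : T).

Lemma head_defaultVmem s : head x0 s = x0 \/ head x0 s \in s.
Proof. by case: s => [|x s]; [left|right; exact: mem_head]. Qed.

Lemma head_mem x s : x \in s -> head x0 s \in s.
Proof. by case: s => // y s _; exact: mem_head. Qed.

End Head.

Section Augmentation.
Variables (G : sgraph) (N : network G) (l : nat) (active : pred G).
Implicit Types (m : G -> G) (u v w : G) (s : seq G).

Definition proposal m v : seq G :=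
  if active v then head [::] [seq v :: s | s <- walks N l v & augmenting m v s] else [::].

Definition augment m w : G :=
  head (m w) [seq mate p w | p <- gather N l (proposal m) w & w \in p].

Definition proposers m : {set G} := [set v | v \in proposal m v].

Variant proposal_spec m v : seq G -> Prop :=
| NoProposal : proposal_spec m v [::]
| Proposal s of active v & augmenting m v s & size s <= l : proposal_spec m v (v :: s).

Lemma proposalP m v : proposal_spec m v (proposal m v).
Proof.
rewrite /proposal; case: ifP => [v_active|_]; last exact: NoProposal.
set ps := [seq _ | _ <- _ & _].
have [->|/mapP[s + ->]] := head_defaultVmem [::] ps; first exact: NoProposal.
by rewrite mem_filter mem_walks => /and3P[aug _ sl]; exact: Proposal.
Qed.

Lemma mem_proposers m v w : w \in proposal m v -> v \in proposers m.
Proof. by rewrite inE; case: proposalP => // s _ _ _; rewrite mem_head. Qed.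

Lemma proposers_augmenting m v s :
  active v -> augmenting m v s -> size s <= l -> v \in proposers m.
Proof.
move=> v_active aug sl; have /andP[vs _] := aug; rewrite inE /proposal v_active.
have /(head_mem [::])/mapP[t _ ->] :
    v :: s \in [seq v :: t | t <- walks N l v & augmenting m v t].
  by rewrite map_f // mem_filter aug mem_walks vs.
exact: mem_head.
Qed.

Lemma proposer_unmatched m v : v \in proposers m -> m v = v.
Proof. by rewrite inE; case: proposalP => // s _ /and5P[_ _ _ /eqP]. Qed.

Lemma odd_size_proposal m v : odd (size (proposal m v)) = false.
Proof. by case: proposalP => // s _ /and5P[_ _ /= -> _ _]. Qed.

Lemma uniq_proposal m v : uniq (proposal m v).
Proof. by case: proposalP => // s _ /and5P[]. Qed.

Lemma sorted_proposal m v : sorted (@adj G) (proposal m v).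
Proof. by case: proposalP => // s _ /and5P[]. Qed.

Lemma size_proposal m v : size (proposal m v) <= l.+1.
Proof. by case: proposalP. Qed.

Lemma proposal_closed m v w : w \in proposal m v -> m w \in proposal m v.
Proof. by case: proposalP => // s _ /and5P[_ _ _ _ /allP closed] _ /closed. Qed.

Lemma proposal_ball m v w : w \in proposal m v -> w \in ball l v.
Proof. by case: proposalP => // s _ /andP[vs _] sl; exact: path_ball. Qed.

Lemma proposal_active m v w : w \in proposal m v -> active v.
Proof. by case: proposalP. Qed.

Lemma augment_uncovered m w : (forall v, w \notin proposal m v) -> augment m w = m w.
Proof.
move=> uncovered; rewrite /augment; set ps := [seq mate _ _ | _ <- _ & _].
have [//|/mapP[p]] := head_defaultVmem (m w) ps.
by rewrite mem_filter => /andP[+ /mem_gather[v _ pE]]; rewrite pE (negPf (uncovered v)).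
Qed.

Hypothesis active_dispersed : dispersed (l + l) active.

Lemma proposals_disjoint m u v w : w \in proposal m u -> w \in proposal m v -> u = v.
Proof.
move=> wu wv; have [u_active v_active] := (proposal_active wu, proposal_active wv).
apply: active_dispersed => //; apply: ball_trans (proposal_ball wv) _.
by rewrite ball_sym; exact: proposal_ball wu.
Qed.

Lemma augment_covered m v w : w \in proposal m v -> augment m w = mate (proposal m v) w.
Proof.
move=> wv; rewrite /augment.
have wv_sym : v \in ball l w by rewrite ball_sym; exact: proposal_ball wv.
have : mate (proposal m v) w \in
    [seq mate p w | p <- gather N l (proposal m) w & w \in p].
  apply: (map_f (fun p => mate p w)); rewrite mem_filter wv.
  by apply/mem_gather; exists v.
move=> /(head_mem (m w))/mapP[p + ->]; rewrite mem_filter => /andP[wp /mem_gather[u _ pE]].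
by rewrite pE in wp *; rewrite (proposals_disjoint wp wv).
Qed.

Lemma augment_neq m v w : w \in proposal m v -> augment m w != w.
Proof.
move=> wv; rewrite (augment_covered wv) mate_neq ?odd_size_proposal //.
exact: uniq_proposal.
Qed.

Lemma augment_pairing m : pairing m -> pairing (augment m).
Proof.
move=> [mK m_adj]; split=> w; have [v wv|uncovered] := pickP (fun v => w \in proposal m v).
- have uniq_p := uniq_proposal m v.
  by rewrite (augment_covered wv) (@augment_covered m v) ?mem_mate ?mateK ?odd_size_proposal.
- rewrite (@augment_uncovered m w) => [|v]; last by rewrite uncovered.
  rewrite augment_uncovered ?mK // => v; apply: contraFN (uncovered v) => /proposal_closed.
  by rewrite mK.
- rewrite (augment_covered wv) => _; apply: mate_rel => //.
  + by rewrite odd_size_proposal.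
  + exact: adj_sym.
  exact: sorted_proposal.
by rewrite augment_uncovered => [|v]; [exact: m_adj|rewrite uncovered].
Qed.

Lemma card_matched_augment m : #|matched m| + #|proposers m| <= #|matched (augment m)|.
Proof.
have disj : matched m :&: proposers m = set0.
  apply/setP => v; rewrite !in_set; apply: contraTF isT => /andP[+ v_prop].
  by rewrite (proposer_unmatched (m := m)) ?eqxx ?inE.
rewrite -cardsUI disj cards0 addn0; apply/subset_leq_card/subsetP => w.
rewrite !in_set => w_in; have [v wv|uncovered] := pickP (fun v => w \in proposal m v).
  exact: augment_neq wv.
by rewrite augment_uncovered => [|v]; [move: w_in; rewrite uncovered orbF|rewrite uncovered].
Qed.

Lemma card_augment_changed m :
  #|[set w | augment m w != m w]| <= l.+1 * (#|matched (augment m)| - #|matched m|).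
Proof.
apply: (@leq_trans (l.+1 * #|proposers m|)); last first.
  by rewrite leq_mul2l; have := card_matched_augment m; lia.
apply: (@leq_trans #|\bigcup_(v in proposers m) [set w in proposal m v]|).
  apply/subset_leq_card/subsetP => w; rewrite inE => changed; apply/bigcupP.
  have [v wv|uncovered] := pickP (fun v => w \in proposal m v).
    by exists v; rewrite ?inE //; have := mem_proposers wv; rewrite inE.
  by move: changed; rewrite augment_uncovered ?eqxx // => v; rewrite uncovered.
apply: leq_trans (card_bigcup_leq _ _ _) _; rewrite mulnC -sum_nat_const.
by apply: leq_sum => v _; rewrite cardsE; apply: leq_trans (card_size _) (size_proposal m v).
Qed.

Lemma augment_changed m v s :
  active v -> augmenting m v s -> size s <= l -> augment m v != m v.
Proof.
move=> v_active aug sl; have v_prop := proposers_augmenting v_active aug sl.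
by rewrite (proposer_unmatched v_prop); apply: (@augment_neq _ v); rewrite inE in v_prop.
Qed.

End Augmentation.

Definition augmenting_ids (z : seq (nat * nat)) : bool :=
  [&& uniq (unzip1 z), ~~ odd (size z), (head (0, 0) z).1 == (head (0, 0) z).2
    & all [pred r | r.2 \in unzip1 z] z].

Lemma augmenting_idsE (G : sgraph) (N : network G) (m : G -> G) v s :
  path (@adj G) v s ->
  augmenting_ids [seq (vid N u, vid N (m u)) | u <- v :: s] = augmenting m v s.
Proof.
have vidI := @vid_inj _ N; rewrite /augmenting_ids /augmenting => ->.
rewrite andTb /unzip1 -map_comp; congr [&& _, _, _ & _].
- exact: map_inj_uniq vidI _.
- by rewrite size_map /= negbK.
- by rewrite /= eq_sym inj_eq.
by rewrite all_map; apply: eq_all => u; exact: (mem_map vidI (v :: s)).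
Qed.

Lemma local_proposal t l (active : netfun bool) (m : vertex_map) :
  local t active -> local_vertex t m ->
  local (t + l) (fun G N v => map (vid N) (proposal N l (active G N) (m G N) v)).
Proof.
move=> act_local m_local.
have vid_local := leq_local (leq0n t) local_vid.
have ids_local := local_walks l (local_map2 pair vid_local m_local).
apply: eq_local (local_map2 (fun (b : bool) zs => if b
  then head [::] [seq unzip1 z | z <- zs & augmenting_ids z] else [::])
  (leq_local (leq_addr l t) act_local) ids_local) => G N v.
rewrite /proposal; case: ifP => // _.
rewrite filter_map -map_comp (eq_in_filter (a2 := augmenting (m G N) v)); last first.
  by move=> s; rewrite mem_walks => /andP[vs _]; exact: augmenting_idsE.
by case: filter => //= s _; rewrite /unzip1 -map_comp.
Qed.

Lemma local_augment t l (active : netfun bool) (m : vertex_map) :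
  local t active -> local_vertex t m ->
  local_vertex (t + l + l) (fun G N => augment N l (active G N) (m G N)).
Proof.
move=> act_local m_local; have prop_local := local_proposal l act_local m_local.
have t_le : t <= t + l + l by rewrite -addnA leq_addr.
have self_local := local_map2 pair (leq_local (leq0n t) local_vid) m_local.
apply: eq_local (local_map2 (fun r ps =>
  head r.2 [seq mate p r.1 | p <- ps & r.1 \in p])
  (leq_local t_le self_local) (local_gather l prop_local)) => G N v.
rewrite /augment /gather (map_comp (map (vid N))) filter_map.
rewrite (eq_filter (a2 := fun p => v \in p)); last first.
  by move=> p; exact: mem_map (@vid_inj _ N) _ _.
by case: filter => //= p _; rewrite mate_map //; exact: vid_inj.
Qed.

(** * Phases *)

(* As long as (k - 1) s exceeds (k + 1) a_i, each step gains more than s / T. *)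
Lemma deficit_closes (k T s : nat) (a : nat -> nat) : 0 < k -> 0 < T ->
  {homo a : i j / i <= j} -> (forall i, k * s <= k.+1 * a i + T * (a i.+1 - a i)) ->
  a T <= s -> k.-1 * s <= k.+1 * a T.
Proof.
move=> k_gt0 T_gt0 a_mono gain aT_le; have [//|deficit] := leqP (k.-1 * s) (k.+1 * a T).
have growth i : i <= T -> i * s.+1 <= T * a i.
  elim: i => // i IH iT; rewrite mulSn -(subnK (a_mono _ _ (leqnSn i))) mulnDr.
  apply: leq_add (IH (ltnW iT)).
  have : k.+1 * a i <= k.+1 * a T by rewrite leq_mul2l a_mono // ltnW.
  have : k * s = k.-1 * s + s by rewrite -{1}(prednK k_gt0) mulSnr.
  have := gain i; lia.
have := growth T (leqnn T); rewrite leq_pmul2l //; lia.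
Qed.

Section Phases.
Variables (G : sgraph) (N : network G) (l : nat) (active : nat -> pred G).
Implicit Types (v : G) (s : seq G) (ms : G -> G).

Fixpoint phases j : G -> G :=
  if j is i.+1 then augment N l (active i) (phases i) else id.

Definition touched i n : {set G} :=
  \bigcup_(c < n) [set v | phases (i + c).+1 v != phases (i + c) v].

Lemma phases_untouched i n v c :
  v \notin touched i n -> c <= n -> phases (i + c) v = phases i v.
Proof.
move=> untouched; elim: c => [|c IH] cn; first by rewrite addn0.
rewrite -IH ?(ltnW cn) // addnS; apply: contraNeq untouched => changed.
by apply/bigcupP; exists (Ordinal cn); rewrite ?inE.
Qed.

Hypothesis active_dispersed : forall j, dispersed (l + l) (active j).

Lemma augmenting_touched i n v s : (exists2 c, c < n & active (i + c) v) ->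
  augmenting (phases i) v s -> size s <= l -> has [in touched i n] (v :: s).
Proof.
move=> [c cn v_active] aug sl; apply: contraT => /hasPn untouched.
have same : {in v :: s, phases i =1 phases (i + c)}.
  by move=> u us; rewrite (phases_untouched (untouched u us) (ltnW cn)).
rewrite (eq_in_augmenting same) in aug.
have /eqP[] := augment_changed N (@active_dispersed _) v_active aug sl.
rewrite -[LHS]/(phases (i + c).+1 v) -addnS.
by rewrite !(phases_untouched (untouched v (mem_head v s))) // ltnW.
Qed.

Lemma pairing_phases j : pairing (phases j).
Proof.
elim: j => [|j IH]; first by split=> // v; rewrite eqxx.
exact: augment_pairing.
Qed.

Lemma card_matched_phases : {homo (fun j => #|matched (phases j)|) : i j / i <= j}.
Proof.
apply: homo_leq => // [i j h|j]; first exact: leq_trans.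
by apply: leq_trans (card_matched_augment N (@active_dispersed j) _); exact: leq_addr.
Qed.

Lemma card_touched i n :
  #|touched i n| <= l.+1 * (#|matched (phases (i + n))| - #|matched (phases i)|).
Proof.
elim: n => [|n IH]; first by rewrite /touched big_ord0 cards0.
rewrite /touched big_ord_recr /=; apply: leq_trans (leq_card_setU _ _) _.
have step := card_augment_changed N (@active_dispersed (i + n)) (phases (i + n)).
apply: leq_trans (leq_add IH step) _; rewrite -mulnDr leq_mul2l addnS /=.
have := card_matched_phases (leq_addr n i); have := card_matched_phases (leqnSn (i + n)).
rewrite /=; lia.
Qed.

Lemma card_matched_sweep k i n ms : k.*2 <= l.+1 ->
  (forall v, exists2 c, c < n & active (i + c) v) -> pairing ms ->
  k * #|matched ms| <= k.+1 * #|matched (phases i)|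
    + k.*2 * l.+1 * (#|matched (phases (i + n))| - #|matched (phases i)|).
Proof.
move=> kl sweeps msP.
have hits v s : augmenting (phases i) v s -> size s < k.*2 -> has [in touched i n] (v :: s).
  by move=> aug sk; apply: augmenting_touched aug _ => //; rewrite -ltnS (leq_trans sk).
apply: leq_trans (card_matched_augmenting_hits (pairing_phases i) msP hits) _.
by rewrite leq_add2l -mulnA leq_mul2l card_touched orbT.
Qed.

Lemma phases_approx k n ms : 0 < k -> k.*2 <= l.+1 ->
  (forall i v, exists2 c, c < n & active (i * n + c) v) -> pairing ms ->
  #|matched (phases (k.*2 * l.+1 * n))| <= #|matched ms| ->
  k.-1 * #|matched ms| <= k.+1 * #|matched (phases (k.*2 * l.+1 * n))|.
Proof.
move=> k_gt0 kl sweeps msP.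
apply: (deficit_closes (a := fun i => #|matched (phases (i * n))|)) => // [|i j ij|i].
- by rewrite muln_gt0 double_gt0 k_gt0.
- by apply: card_matched_phases; rewrite leq_mul2r ij orbT.
by rewrite (mulSnr i); exact: card_matched_sweep.
Qed.

End Phases.

Lemma local_phases t l (active : nat -> netfun bool) j : (forall i, local t (active i)) ->
  local_vertex (t + j * (l + l)) (fun G N => phases N l (fun i => active i G N) j).
Proof.
move=> act_local; elim: j => [|j IH]; first by apply: leq_local local_vid.
have -> : t + j.+1 * (l + l) = t + j * (l + l) + l + l by rewrite mulSnr !addnA.
exact: local_augment (leq_local (leq_addr _ t) (act_local j)) IH.
Qed.

Definition mark_ports (m : vertex_map) : netfun (pred nat) :=
  fun G N v i => nth false [seq m G N v == u | u <- ports N v] i.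

Lemma local_mark_ports t (m : vertex_map) :
  local_vertex t m -> local t.+1 (mark_ports m).
Proof.
move=> m_local; apply: eq_local (local_map2
  (fun j js i => nth false [seq j == j' | j' <- js] i)
  (leq_local (leqnSn t) m_local) (local_ports (leq_local (leq0n t) local_vid))) => G N v.
apply/funext => i; rewrite -map_comp; congr (nth _ _ i).
by apply: eq_map => u /=; rewrite (inj_eq (@vid_inj _ N)).
Qed.

Lemma mark_portsP (m : vertex_map) G (N : network G) (u v : G) :
  pairing (m G N) -> adj u v ->
  mark_ports m N u (port N u v) = ([set u; v] \in pairs (m G N)).
Proof.
move=> mP uv; rewrite mem_pairs // /mark_ports (nth_map u) ?nth_index //.
  by rewrite mem_ports.
by rewrite index_mem mem_ports.
Qed.

Definition approx_phases (k b : nat) : nat := k.*2 * k.*2.+1 * 2 ^ b.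

Definition approx_partner (k t d a : nat) : vertex_map := fun G N =>
  let b := iter t (linial_bits d) a in
  phases N k.*2 (fun i v => coloring (k.*2 + k.*2) d a t N v == i %% 2 ^ b)
    (approx_phases k b).

Lemma local_approx_partner k t d a :
  local_vertex (t * (k.*2 + k.*2) + approx_phases k (iter t (linial_bits d) a) * (k.*2 + k.*2))
    (approx_partner k t d a).
Proof.
apply: local_phases => i.
exact: local_map (fun c => c == i %% _) _ _ (local_coloring (k.*2 + k.*2) d a t).
Qed.

Lemma approx_partnerP k t d a G (N : network G) : 0 < k ->
  (forall v, vid N v < 2 ^ a) -> (forall v : G, #|ball (k.*2 + k.*2) v| <= 2 ^ d) ->
  pairing (approx_partner k t d a N) /\
  forall ms : G -> G, pairing ms -> #|matched (approx_partner k t d a N)| <= #|matched ms| ->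
    k.-1 * #|matched ms| <= k.+1 * #|matched (approx_partner k t d a N)|.
Proof.
move=> k_gt0 vid_lt ball_le.
have colP := coloring_distance (i := t) vid_lt ball_le.
have class_dispersed i := dispersed_coloring (c := i) colP.
split=> [|ms msP]; first exact: pairing_phases.
apply: phases_approx => // i v.
exists (coloring (k.*2 + k.*2) d a t N v); first exact: coloring_lt.
by rewrite modnMDl modn_small // coloring_lt.
Qed.

(** * Number of rounds *)

Definition id_bits (p : {poly nat}) (n : nat) : nat := (trunc_log 2 p.[n]%R).+1.

Lemma horner_nat_le (p : {poly nat}) : exists c e, forall n, p.[n]%R <= c * n.+1 ^ e.
Proof.
rewrite /horner; elim: (polyseq p) => [|a s [c [e IH]]]; first by exists 0, 0.
exists (c + a), e.+1 => n; rewrite /= mulnDl leq_add ?leq_pmulr ?expn_gt0 //.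
by rewrite expnSr mulnA leq_mul.
Qed.

Lemma id_bits_le (p : {poly nat}) : exists b, forall n, id_bits p n <= b.+1 * n.+1.
Proof.
have [c [e p_le]] := horner_nat_le p; exists (c + e) => n; rewrite /id_bits.
have [->|pn_gt0] := posnP p.[n]%R; first by rewrite trunc_log0 muln_gt0.
suff : trunc_log 2 p.[n]%R <= c + e * n by nia.
rewrite -(leq_exp2l (m := 2)) //; apply: leq_trans (trunc_logP _ pn_gt0) _ => //.
apply: leq_trans (p_le n) _; rewrite expnD leq_mul ?(ltnW (ltn_expl _ _)) //.
rewrite mulnC expnM; case: (e) => // e'; rewrite leq_exp2r //.
exact: ltn_expl.
Qed.

Definition ball_bits (l D : nat) : nat := l * (trunc_log 2 D).+1.

Lemma card_ball_le_exp2 (G : sgraph) l (v : G) :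
  #|ball l v| <= 2 ^ ball_bits l (max_degree G).
Proof.
apply: leq_trans (card_ball _ _) _; rewrite /ball_bits mulnC expnM.
by case: l => // l; rewrite leq_exp2r ?trunc_log_ltn.
Qed.

Lemma exp2_le_expn D x y : 1 < D -> x <= y * (trunc_log 2 D).+1 -> 2 ^ x <= D ^ (2 * y).
Proof.
move=> D_gt1 xy; apply: (@leq_trans (2 ^ (y * (trunc_log 2 D).+1))).
  by rewrite leq_pexp2l.
rewrite mulnC expnM [leqRHS]expnM; case: y {xy} => // y; rewrite leq_exp2r //.
by rewrite expnS -mulnn leq_mul // trunc_logP // ltnW.
Qed.

Lemma phase_rounds_le k K D b : 0 < k -> 0 < K -> 1 < D ->
  b <= K * (ball_bits (k.*2 + k.*2) D).+1 ->
  (approx_phases k b * (k.*2 + k.*2)).+1 <= D ^ (18 * K * k).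
Proof.
move=> k_gt0 K_gt0 D_gt1 b_le.
have -> : 18 * K * k = 2 * (9 * K * k) by lia.
apply: leq_trans (exp2_le_expn (x := 8 * k + b) D_gt1 _).
  have -> : 8 * k = 5 * k + k * 3 by lia.
  have k3_le : k ^ 3 <= 2 ^ (k * 3) by rewrite expnM leq_exp2r // ltnW // ltn_expl.
  have exp5k_ge : 2 ^ 5 <= 2 ^ (5 * k) by rewrite leq_pexp2l // leq_pmulr.
  rewrite expnD [X in _ < X * _]expnD.
  apply: leq_trans _ (leq_mul (leq_mul exp5k_ge k3_le) (leqnn _)).
  rewrite /approx_phases -!muln2; have : 0 < 2 ^ b by rewrite expn_gt0.
  move: (2 ^ b) => B B_gt0; nia.
have : 0 < trunc_log 2 D by rewrite trunc_log_gt0 D_gt1.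
move: b_le; rewrite /ball_bits; nia.
Qed.

Section LogStar.
Variable R : realType.
Local Open Scope ring_scope.
Implicit Types x y A : R.

Let ln2_gt0 : 0 < ln (2 : R).
Proof. by rewrite ln_gt0 ?ltr1n. Qed.

Lemma ler_log2 x y : 0 < x -> x <= y -> log2 x <= log2 y.
Proof.
move=> x_gt0 xy; rewrite /log2 ler_pM2r ?invr_gt0 ?ln2_gt0 // ler_ln ?posrE //.
exact: lt_le_trans xy.
Qed.

Lemma log2M x y : 0 < x -> 0 < y -> log2 (x * y) = log2 x + log2 y.
Proof. by move=> x_gt0 y_gt0; rewrite /log2 lnM ?posrE // mulrDl. Qed.

Lemma log2_exp2 n : log2 (2 ^+ n : R) = n%:R.
Proof. by rewrite /log2 lnXn // -[_ *+ n]mulr_natl mulfK // gt_eqF // ln2_gt0. Qed.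

Lemma iter_log_star_le1 x : iter (log_star x) (@log2 R) x <= 1.
Proof. by rewrite /log_star; case: ex_minnP. Qed.

Lemma lt_log_star x i : (i < log_star x)%N -> 1 < iter i (@log2 R) x.
Proof.
rewrite /log_star; case: ex_minnP => n _ n_min i_lt.
by rewrite ltNge; apply/negP => /n_min; rewrite leqNgt i_lt.
Qed.

Lemma linial_bits_le d a A y : (0 < a)%N -> 1 <= A -> 2 * (d%:R + 2 + log2 A) <= A ->
  1 < y -> a%:R <= A * (1 + y) -> (linial_bits d a)%:R <= A * (1 + log2 y).
Proof.
move=> a_gt0 A_ge1 A_large y_gt1 a_le.
have log2_ge0 x : 1 <= x -> 0 <= log2 x.
  by move=> x_ge1; rewrite -[0]/(0%:R) -log2_exp2 ler_log2 ?expr0.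
have log_a_le : (trunc_log 2 a)%:R <= log2 A + (1 + log2 y).
  have <- : log2 (A * (2 * y)) = log2 A + (1 + log2 y).
    by rewrite !log2M ?(log2_exp2 1) //; lra.
  rewrite -(log2_exp2 (trunc_log 2 a)); apply: ler_log2; first by rewrite exprn_gt0.
  apply: (@le_trans _ _ a%:R); first by rewrite -natrX ler_nat trunc_logP.
  by apply: le_trans a_le _; rewrite ler_pM2l; lra.
have A_log_ge0 := log2_ge0 A A_ge1; have y_log_ge0 := log2_ge0 y (ltW y_gt1).
have d_ge0 : 0 <= d%:R :> R by [].
have : 2 * log2 y <= A * log2 y by rewrite ler_wpM2r //; lra.
have -> : (linial_bits d a)%:R = 2 * (d%:R + (trunc_log 2 a)%:R + 1) :> R.
  by rewrite /linial_bits -mul2n natrM -(natr1 (d + _)) (natrD _ d).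
lra.
Qed.

Lemma iter_linial_bits_le d a A x : (0 < a)%N -> 1 <= A -> 2 * (d%:R + 2 + log2 A) <= A ->
  a%:R <= A * (1 + x) -> (iter (log_star x) (linial_bits d) a)%:R <= 2 * A.
Proof.
move=> a_gt0 A_ge1 A_large a_le.
have bits_gt0 i : (0 < iter i (linial_bits d) a)%N by case: i.
have bits_le i : (i <= log_star x)%N ->
    (iter i (linial_bits d) a)%:R <= A * (1 + iter i (@log2 R) x).
  elim: i => // i IH i_lt; apply: linial_bits_le (bits_gt0 i) _ _ _ _ => //.
    exact: lt_log_star.
  exact/IH/ltnW.
apply: le_trans (bits_le _ (leqnn _)) _; have := iter_log_star_le1 x; nra.
Qed.

Lemma color_bits_le (p : {poly nat}) : exists2 K, (0 < K)%N & forall n d,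
  (iter (log_star (n%:R : R)) (linial_bits d) (id_bits p n) <= K * d.+1)%N.
Proof.
have [b b_le] := id_bits_le p; exists (2 * 2 ^ (b + 4))%N; first by rewrite muln_gt0 expn_gt0.
move=> n d; rewrite -(ler_nat R) -mulnA natrM; apply: iter_linial_bits_le => //.
- by rewrite ler1n muln_gt0 expn_gt0.
- apply: (@le_trans _ _ (2 * (d%:R + 2 + (b + 4 + d)%:R))).
    rewrite ler_pM2l // lerD2l -(log2_exp2 (b + 4 + d)) ler_log2 ?ltr0n ?muln_gt0 ?expn_gt0 //.
    by rewrite -natrX ler_nat [(2 ^ (_ + d))%N]expnD leq_mul // ltn_expl.
  rewrite -!(natrM, natrD) ler_nat expnD; have : (b < 2 ^ b)%N by rewrite ltn_expl.
  by move: (2 ^ b)%N => B bB; nia.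
rewrite -[1]/(1%:R) -natrD -natrM ler_nat; apply: leq_trans (b_le n) _.
rewrite expnD; have : (b < 2 ^ b)%N by rewrite ltn_expl.
by move: (2 ^ b)%N => B bB; nia.
Qed.

End LogStar.

Section MatchingAlgorithm.
Variables (p : {poly nat}) (k : nat) (t : nat -> nat).

(* A graph of maximum degree at most 1 is its own matching. *)
Definition matching_rounds (n D : nat) : nat :=
  if 1 < D then
    (t n * (k.*2 + k.*2)
     + approx_phases k (iter (t n) (linial_bits (ball_bits (k.*2 + k.*2) D)) (id_bits p n))
       * (k.*2 + k.*2)).+1
  else 0.

Definition matching_output (n D : nat) : netfun (pred nat) :=
  if 1 < D then mark_ports (approx_partner k (t n) (ball_bits (k.*2 + k.*2) D) (id_bits p n))
  else fun _ _ _ => predT.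

Lemma local_matching_output n D : local (matching_rounds n D) (matching_output n D).
Proof.
rewrite /matching_rounds /matching_output; case: ifP => _; last by exists (fun _ => predT).
exact/local_mark_ports/local_approx_partner.
Qed.

Lemma matching_outputP (G : sgraph) (N : network G) : 0 < k ->
  (forall v : G, vid N v <= p.[#|G|]%R) ->
  exists M : {set {set G}},
    [/\ forall u v, adj u v ->
          matching_output #|G| (max_degree G) N u (port N u v) = ([set u; v] \in M),
        matching M &
        forall Ms : {set {set G}}, maximum_matching Ms -> k.-1 * #|Ms| <= k.+1 * #|M|].
Proof.
move=> k_gt0 vid_le; rewrite /matching_output; case: ltnP => [_|deg_le1]; last first.
  exists (edges G); split=> [u v uv||Ms [[Ms_edges _] _]].
  - by rewrite mem_edges uv.
  - exact: matching_edges.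
  by apply: leq_mul (subset_leq_card Ms_edges); rewrite leqW ?leq_pred.
have vid_lt v : vid N v < 2 ^ id_bits p #|G|.
  exact: leq_ltn_trans (vid_le v) (trunc_log_ltn _ _).
have := approx_partnerP (t #|G|) k_gt0 vid_lt (@card_ball_le_exp2 G _).
set m := approx_partner _ _ _ _ => -[mP m_approx]; exists (pairs (m G N)).
split=> [u v|| Ms [matMs maxMs]]; [exact: mark_portsP|exact: matching_pairs|].
have := m_approx _ (pairing_partner matMs).
rewrite card_matched_pairs // card_matched_partner // leq_double.
by move=> /(_ (maxMs _ (matching_pairs mP))); rewrite -!doubleMr leq_double.
Qed.

End MatchingAlgorithm.

Local Open Scope ring_scope.

Lemma approx_ratio (R : realType) (eps : R) k (x y : nat) : 0 < eps -> (0 < k)%N ->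
  2 / eps < k.+1%:R -> (k.-1 * x <= k.+1 * y)%N -> (1 - eps) * x%:R <= y%:R.
Proof.
move=> eps_gt0 k_gt0; rewrite ltr_pdivrMr // -(ler_nat R) !natrM => k_large xy.
rewrite -(ler_pM2l (ltr0Sn R k)); apply: le_trans xy; rewrite mulrA ler_wpM2r //.
have -> : k.-1%:R = k.+1%:R - 2 :> R by rewrite -{2}(prednK k_gt0) -!natr1; lra.
lra.
Qed.

Lemma matching_rounds_le (R : realType) (p : {poly nat}) (eps : R) k K n D :
  0 < eps -> eps < 1 -> (0 < k)%N -> k%:R <= 2 / eps -> (0 < K)%N ->
  (forall d, iter (log_star (n%:R : R)) (linial_bits d) (id_bits p n) <= K * d.+1)%N ->
  (matching_rounds p k (fun n => log_star (n%:R : R)) n D)%:R <=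
    D%:R `^ (36 * K%:R / eps) + 8 / eps ^+ 2 * (log_star (n%:R : R))%:R.
Proof.
move=> eps_gt0 eps_lt1 k_gt0 k_le K_gt0 bits_le; rewrite /matching_rounds.
have log_ge0 : 0 <= 8 / eps ^+ 2 * (log_star (n%:R : R))%:R.
  by rewrite mulr_ge0 // divr_ge0 // exprn_ge0 // ltW.
case: ltnP => [D_gt1|_]; last by rewrite addr_ge0 ?powR_ge0.
rewrite -addnS natrD addrC lerD //.
  apply: (@le_trans _ _ (D ^ (18 * K * k))%:R).
    by rewrite ler_nat phase_rounds_le.
  rewrite natrX -powR_mulrn // ler_powR // ?ler1n ?(ltnW D_gt1) // natrM.
  have -> : 36 * K%:R / eps = (18 * K)%:R * (2 / eps) :> R by rewrite natrM; lra.
  by rewrite ler_wpM2l.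
rewrite natrM mulrC ler_wpM2r // ler_pdivlMr ?exprn_gt0 //.
move: k_le; rewrite ler_pdivlMr // -!muln2 -mulnDr !natrM !natrD expr2; nra.
Qed.

Theorem theorem20 (R : realType) (p : {poly nat}) :
  exists C1 C2 : R, 0 < C1 /\ 0 < C2 /\
    forall eps : R, 0 < eps -> eps < 1 ->
    exists (A : algorithm) (r : nat -> nat -> nat),
      (forall n D : nat,
         (r n D)%:R <= D%:R `^ (C1 / eps)
                       + C2 / eps ^+ 2 * (log_star (n%:R : R))%:R) /\
      (forall (G : sgraph) (N : network G),
         (forall v : G, (vid N v <= p.[#|G|])%N) ->
         exists M : {set {set G}},
           [/\ outputs_edge_set A N (r #|G| (max_degree G)) M,
               matching M &
               forall Mstar : {set {set G}}, maximum_matching Mstar ->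
                 (1 - eps) * #|Mstar|%:R <= #|M|%:R]).
Proof.
have [K K_gt0 bits_le] := color_bits_le R p.
exists (36 * K%:R), 8; split; first by rewrite mulr_gt0 ?ltr0n.
split=> // eps eps_gt0 eps_lt1; pose k := Num.truncn (2 / eps).
have eps2_ge2 : 2 <= 2 / eps by rewrite ler_pdivlMr //; lra.
have /andP[k_le k_gt] : k%:R <= 2 / eps < k.+1%:R.
  by rewrite truncn_itv // (le_trans _ eps2_ge2).
have k_gt0 : (0 < k)%N by rewrite -ltnS -(ltr_nat R); apply: le_lt_trans k_gt; lra.
pose t n := log_star (n%:R : R).
have [A A_output] := algorithm_of_local (local_matching_output p k t).
exists A, (matching_rounds p k t); split=> [n D|G N vid_le].
  exact: matching_rounds_le.
have [M [M_output M_matching M_approx]] := matching_outputP t k_gt0 vid_le.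
exists M; split=> // [u v uv|Mstar /M_approx]; first by rewrite A_output M_output.
exact: approx_ratio.
Qed.
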